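(* Let $\mathbf{X}$ be a Lie system on $\mathbb{R}^n$ and $\mathbf{Y}$ a Lie system on $\mathbb{R}^m$, with $m<n$. Let $r^X|_U$ and $r^Y|_{U'}$ be the maximum (and constant) ranks of their associated generalized distributions $\mathcal{D}^X\subset T\mathbb{R}^n$ and $\mathcal{D}^Y\subset T\mathbb{R}^m$ on certain open subsets $U\subset\mathbb{R}^n$ and $U'\subset\mathbb{R}^m$, respectively. If $r^X|_U\neq r^Y|_{U'}$, then $\mathbf{X}$ and $\mathbf{Y}$ are not locally diffeomorphic Lie systems.
   Context: A Lie system on $\mathbb{R}^n$ is a time-dependent vector field $\mathbf{X}=\sum_{\alpha=1}^r b_\alpha(t)\mathbf{X}_\alpha$, $b_\alpha\in C^\infty(\mathbb{R})$, where the vector fields $\mathbf{X}_1,\dots,\mathbf{X}_r$ on $\mathbb{R}^n$ span an $r$-dimensional real Lie algebra $V^X$, a Vessiot--Guldberg (VG) Lie algebra of $\mathbf{X}$. Its generalized distribution is $\mathcal{D}^X_\xi=\{\mathbf{Z}|_\xi:\mathbf{Z}\in V^X\}\subset T_\xi\mathbb{R}^n$, with rank $\dim\mathcal{D}^X_\xi$ at $\xi$. ''Maximum rank on $U$'' means that $U$ is the open set of points where the rank attains its maximum over the whole space, so the rank is constant on $U$; similarly for $U'$. Reduction by invariants: let $k<n$ be the rank of $\mathcal{D}^X$ on $U$ and $\chi_0=n-k$. Take (locally on $U$) functionally independent functions $\varphi_1,\dots,\varphi_{\chi_0}$ with $\mathbf{X}_\alpha(\varphi_i)=0$ for all $\alpha,i$,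 put $\psi=(\varphi_1,\dots,\varphi_{\chi_0})$, let $\lambda$ be a regular value of $\psi$ with nonempty preimage, and take a diffeomorphism $\phi:W'\to W$ from an open set $W'\subset\mathbb{R}^k$ onto an open subset $W$ of the $k$-dimensional submanifold $\psi^{-1}(\lambda)$. The Lie system $\mathbf{X}^{\mathrm{red}}=\sum_\alpha b_\alpha(t)(\phi^{-1})_*(\mathbf{X}_\alpha)$ on $W'\subset\mathbb{R}^k$, with VG Lie algebra $(\phi^{-1})_*(V^X)$, is called a reduction of $\mathbf{X}$ by invariants to $\mathbb{R}^k$. Two Lie systems on spaces of equal dimension are locally diffeomorphic if there is a diffeomorphism between nonempty open subsets of their domains whose push-forward carries the VG Lie algebra of one onto that of the other. For $m<n$, a Lie system $\mathbf{Y}$ on $\mathbb{R}^m$ is locally diffeomorphic to a Lie system $\mathbf{X}$ on $\mathbb{R}^n$ if $\mathbf{X}$ can be reduced by invariants to a Lie system $\mathbf{X}^{\mathrm{red}}$ on (an open subset of) $\mathbb{R}^m$ which is locally diffeomorphic to $\mathbf{Y}$. *)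

(* Defs.v *)
From HB Require Import structures.
From mathcomp Require Import all_boot all_order all_algebra.
From mathcomp Require Import all_classical all_reals all_analysis.
Import Order.TTheory GRing.Theory Num.Theory.
Import numFieldNormedType.Exports.

Set Implicit Arguments.
Unset Strict Implicit.
Unset Printing Implicit Defensive.

Local Open Scope classical_set_scope.
Local Open Scope ring_scope.

(* C^oo on an open set U: every iterated directional derivative of f is Frechet
   differentiable at every point of U. *)
Definition smooth_on (R : realType) (V W : normedModType R)
    (U : set V) (f : V -> W) : Prop :=
  forall (vs : seq V) (x : V), U x ->
    differentiable (foldr (fun v g => 'D_v g) f vs) x.

(* Smoothness on an arbitrary subset A: f locally extends to a C^oo map on an
   open set. On an open set this is [smooth_on]; on an embedded submanifold it
   is smoothness for the submanifold structure. *)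
Definition smooth_subset (R : realType) (V W : normedModType R)
    (A : set V) (f : V -> W) : Prop :=
  forall x, A x -> exists (O : set V) (F : V -> W),
    [/\ open O, O x, smooth_on O F & forall y, A y -> O y -> f y = F y].

Definition diffeo_between (R : realType) (V W : normedModType R)
    (A : set V) (B : set W) (f : V -> W) (g : W -> V) : Prop :=
  [/\ forall x, A x -> B (f x) /\ g (f x) = x,
      forall y, B y -> A (g y) /\ f (g y) = y,
      smooth_subset A f & smooth_subset B g].

(* A vector field on an open subset of R^n; only its values on that subset
   matter. *)
Definition vfield (R : realType) (n : nat) : Type := 'rV[R]_n -> 'rV[R]_n.

Definition lie_bracket (R : realType) (n : nat) (Z1 Z2 : vfield R n) :
    vfield R n :=
  fun x => 'D_(Z1 x) Z2 x - 'D_(Z2 x) Z1 x.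

Definition lie_deriv (R : realType) (n : nat) (Z : vfield R n)
    (h : 'rV[R]_n -> R) : 'rV[R]_n -> R :=
  fun x => 'D_(Z x) h x.

(* The generators are a basis of the Vessiot--Guldberg Lie algebra: they are
   linearly independent over R as vector fields on D, and their span is closed
   under the bracket. *)
Record lie_system (R : realType) (n : nat) (D : set 'rV[R]_n) : Type :=
  LieSystem {
    ls_dim : nat;
    ls_coef : 'I_ls_dim -> R -> R;
    ls_gen : 'I_ls_dim -> vfield R n;
    ls_open : open D;
    ls_coef_smooth : forall a, smooth_on setT (ls_coef a);
    ls_gen_smooth : forall a, smooth_on D (ls_gen a);
    ls_gen_free : forall c : 'I_ls_dim -> R,
      (forall x, D x -> \sum_(a < ls_dim) c a *: ls_gen a x = 0) ->
      forall a, c a = 0;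
    ls_gen_closed : forall a b, exists c : 'I_ls_dim -> R,
      forall x, D x ->
        lie_bracket (ls_gen a) (ls_gen b) x
        = \sum_(e < ls_dim) c e *: ls_gen e x
  }.

Definition ls_field (R : realType) (n : nat) (D : set 'rV[R]_n)
    (X : lie_system D) (t : R) : vfield R n :=
  fun x => \sum_(a < ls_dim X) ls_coef a t *: ls_gen a x.

(* The Vessiot--Guldberg Lie algebra: the real span of the generators, as
   vector fields on D. *)
Definition VG (R : realType) (n : nat) (D : set 'rV[R]_n)
    (X : lie_system D) : set (vfield R n) :=
  [set Z | exists c : 'I_(ls_dim X) -> R,
    forall x, D x -> Z x = \sum_(a < ls_dim X) c a *: ls_gen a x].

Definition distribution (R : realType) (n : nat) (D : set 'rV[R]_n)
    (X : lie_system D) (xi : 'rV[R]_n) : {vspace 'rV[R]_n} :=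
  <<[seq ls_gen (l := X) a xi | a <- enum 'I_(ls_dim X)]>>%VS.

Lemma distributionP (R : realType) (n : nat) (D : set 'rV[R]_n)
    (X : lie_system D) (xi v : 'rV[R]_n) : D xi ->
  v \in distribution X xi <-> exists2 Z, VG X Z & Z xi = v.
Proof.
move=> Dxi; rewrite /distribution span_def big_map big_enum /=; split.
- move=> /memv_sumP[w wP ->].
  have /choice[c cP] : forall a, exists k, w a = k *: ls_gen (l := X) a xi.
    by move=> a; have /vlineP[k ->] := wP a isT; exists k.
  exists (fun x => \sum_(a < ls_dim X) c a *: ls_gen a x); first by exists c.
  by apply: eq_bigr => a _; rewrite cP.
- move=> [Z [c cP] <-]; rewrite cP//.
  by apply: memv_sumr => a _; rewrite memvZ// memv_line.
Qed.

Definition dist_rank (R : realType) (n : nat) (D : set 'rV[R]_n)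
    (X : lie_system D) (xi : 'rV[R]_n) : nat :=
  \dim (distribution X xi).

Definition max_rank_set (R : realType) (n : nat) (D : set 'rV[R]_n)
    (X : lie_system D) : set 'rV[R]_n :=
  [set xi | D xi /\
    forall eta, D eta -> (dist_rank X eta <= dist_rank X xi)%N].

Definition max_rank_on (R : realType) (n : nat) (D : set 'rV[R]_n)
    (X : lie_system D) (U : set 'rV[R]_n) (r : nat) : Prop :=
  U = max_rank_set X /\ forall xi, U xi -> dist_rank X xi = r.

(* f_* Z = Z' along f(A), for f injective on the open set A.  For a
   diffeomorphism f this is also (f^-1)_* Z' = Z on A. *)
Definition is_pushforward (R : realType) (n p : nat) (A : set 'rV[R]_n)
    (f : 'rV[R]_n -> 'rV[R]_p) (Z : vfield R n) (Z' : vfield R p) : Prop :=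
  forall x, A x -> 'd f x (Z x) = Z' (f x).

(* f_* (V restricted to A) = V' restricted to f(A). *)
Definition carries_onto (R : realType) (n p : nat) (A : set 'rV[R]_n)
    (f : 'rV[R]_n -> 'rV[R]_p)
    (V : set (vfield R n)) (V' : set (vfield R p)) : Prop :=
  (forall Z, V Z -> exists2 Z', V' Z' & is_pushforward A f Z Z') /\
  (forall Z', V' Z' -> exists2 Z, V Z & is_pushforward A f Z Z').

Definition locally_diffeomorphic (R : realType) (n : nat)
    (D1 D2 : set 'rV[R]_n) (X : lie_system D1) (Y : lie_system D2) : Prop :=
  exists (A B : set 'rV[R]_n) (f g : 'rV[R]_n -> 'rV[R]_n),
    [/\ [/\ open A, A !=set0 & A `<=` D1],
        [/\ open B, B !=set0 & B `<=` D2],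
        diffeo_between A B f g
      & carries_onto A f (VG X) (VG Y)].

Definition diff_independent (R : realType) (n p : nat)
    (phi : 'I_p -> 'rV[R]_n -> R) (x : 'rV[R]_n) : Prop :=
  forall c : 'I_p -> R,
    (forall v, \sum_(i < p) c i * 'd (phi i) x v = 0) -> forall i, c i = 0.

(* The differentials need only be independent at generic points of O: on a
   dense subset, which is automatically open. *)
Definition functionally_independent (R : realType) (n p : nat)
    (O : set 'rV[R]_n) (phi : 'I_p -> 'rV[R]_n -> R) : Prop :=
  O `<=` closure [set x | O x /\ diff_independent phi x].

Definition regular_value (R : realType) (n p : nat) (O : set 'rV[R]_n)
    (psi : 'rV[R]_n -> 'rV[R]_p) (lam : 'rV[R]_p) : Prop :=
  forall x, O x -> psi x = lam -> forall w, exists v, 'd psi x v = w.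

(* Xred is a reduction of X by invariants; its domain W' is an open subset of
   R^k, where k is the rank of the distribution of X on the set U of points of
   maximal rank.  The invariants phi_i are defined on an open O included in U,
   and f : W' -> W is the parametrization of an open piece W of the level
   set, with inverse g.  The generators of Xred are a basis of
   (f^-1)_* V^X and need not be the (f^-1)_* X_a, which may become linearly
   dependent. *)
Definition reduction_by_invariants (R : realType) (n k : nat)
    (X : lie_system [set: 'rV[R]_n])
    (W' : set 'rV[R]_k) (Xred : lie_system W') : Prop :=
  [/\ (k < n)%N,
      forall xi, max_rank_set X xi -> dist_rank X xi = k
    & exists (O : set 'rV[R]_n) (phi : 'I_(n - k) -> 'rV[R]_n -> R)
             (lam : 'rV[R]_(n - k)) (W : set 'rV[R]_n)
             (f : 'rV[R]_k -> 'rV[R]_n) (g : 'rV[R]_n -> 'rV[R]_k),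
      let psi := fun x => \row_(i < n - k) phi i x in
      let level := [set x | O x /\ psi x = lam] in
      [/\ [/\ open O, O `<=` max_rank_set X
            & forall i, smooth_on O (phi i)],
          functionally_independent O phi /\
          (forall a i x, O x -> lie_deriv (ls_gen (l := X) a) (phi i) x = 0),
          regular_value O psi lam /\ level !=set0,
          (exists2 Q, open Q & W = Q `&` level) /\
          diffeo_between W' W f g
        & (* Xred = sum_a b_a(t) (f^-1)_* X_a *)
          (exists Z : 'I_(ls_dim X) -> vfield R k,
             (forall a, is_pushforward W' f (Z a) (ls_gen a)) /\
             (forall t u, W' u ->
                ls_field Xred t u
                = \sum_(a < ls_dim X) ls_coef a t *: Z a u)) /\
          carries_onto W' f (VG Xred) (VG X)]].

Definition locally_diffeomorphic_lower (R : realType) (m n : nat)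
    (Y : lie_system [set: 'rV[R]_m]) (X : lie_system [set: 'rV[R]_n]) : Prop :=
  exists (W' : set 'rV[R]_m) (Xred : lie_system W'),
    reduction_by_invariants X Xred /\ locally_diffeomorphic Xred Y.

(* Main.v *)
Require Import Defs.
From HB Require Import structures.
From mathcomp Require Import all_boot all_order all_algebra.
From mathcomp Require Import all_classical all_reals all_analysis.
Import Order.TTheory GRing.Theory Num.Theory.
Import numFieldNormedType.Exports.

Set Implicit Arguments.
Unset Strict Implicit.

Local Open Scope classical_set_scope.
Local Open Scope ring_scope.

(* A pushforward of the VG Lie algebra maps the distribution onto the
   distribution, pointwise through the differential; an arbitrary linear map
   does not raise the rank and an injective one preserves it.  Where X has its
   maximal rank k, the level set of the invariants has dimension k, so a
   reduction to R^k has distribution of full rank k = m.  A local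
   diffeomorphism then transports full rank m to some point of the domain of
   Y, where it is necessarily the maximal rank of Y. *)

(** The first-order expansion of [f] at [x] depends only on its germ there, so it serves for [g] as
    well, and the differential is unique. This lets a map be compared with its local smooth
    extensions. *)
Lemma near_eq_diff (R : realType) (V W : normedModType R) (f g : V -> W)
    (x : V) :
  {near x, f =1 g} -> differentiable f x ->
  differentiable g x /\ 'd g x = 'd f x :> (V -> W).
Proof.
move=> fg /diff_locallyP[cf ef].
have eg : g \o shift x = cst (g x) + 'd f x +o_ 0 id.
  apply/eqaddoP => e e0.
  move/eqaddoP: ef => /(_ e e0) ef.
  have fg0 : \forall h \near 0, f (h + x) = g (h + x).
    by move: fg; rewrite (@near_shift _ _ 0 x) subr0.
  apply: filterS2 ef fg0 => h /=.
  rewrite !fctE /= => + fgh; rewrite fgh.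
  by rewrite (nbhs_singleton fg).
have dE : 'd g x = 'd f x :> (V -> W) by exact: diff_unique.
by split=> //; apply/diff_locallyP; rewrite dE.
Qed.

Lemma smooth_subset_differentiable (R : realType) (V W : normedModType R)
    (A : set V) (f : V -> W) (x : V) :
  open A -> smooth_subset A f -> A x -> differentiable f x.
Proof.
move=> oA sf Ax; have [N [F [oN Nx sF fF]]] := sf x Ax.
apply: (proj1 (near_eq_diff _ (sF [::] x Nx))).
apply: filterS2 (open_nbhs_nbhs (conj oA Ax)) (open_nbhs_nbhs (conj oN Nx)).
by move=> y Ay Ny /=; rewrite fF.
Qed.

(** The chain rule for [g \o f], which is the identity near [x], makes ['d g (f x)] a left inverse
    of ['d f x]. *)
Lemma diffeo_diff_inj (R : realType) (V W : normedModType R)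
    (A : set V) (B : set W) (f : V -> W) (g : W -> V) (x : V) :
  open A -> open B -> diffeo_between A B f g -> A x -> injective ('d f x).
Proof.
move=> oA oB [fAB gBA sf sg] Ax.
have [Bfx _] := fAB x Ax.
have df := smooth_subset_differentiable oA sf Ax.
have dg := smooth_subset_differentiable oB sg Bfx.
have gf1 : {near x, id =1 g \o f}.
  apply: filterS (open_nbhs_nbhs (conj oA Ax)) => y Ay /=.
  by have [_ ->] := fAB y Ay.
have [_] := near_eq_diff gf1 ex_diff.
rewrite diff_comp// diff_val => gfE.
by apply: (can_inj (g := 'd g (f x))) => v; have := congr1 (@^~ v) gfE.
Qed.

(** Each half of [carries_onto] gives one inclusion: the second lifts vectors back to [X], the first
    pushes them to [Y]. *)
Lemma carries_onto_distribution (R : realType) (n p : nat)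
    (D : set 'rV[R]_n) (E : set 'rV[R]_p) (X : lie_system D) (Y : lie_system E)
    (A : set 'rV[R]_n) (f : 'rV[R]_n -> 'rV[R]_p) (x : 'rV[R]_n) :
  carries_onto A f (VG X) (VG Y) -> A x -> D x -> E (f x) ->
  Defs.distribution Y (f x) = (linfun ('d f x) @: Defs.distribution X x)%VS.
Proof.
move=> [XY YX] Ax Dx Efx; apply/vspaceP => w; apply/idP/idP.
  move/(distributionP _ _ Efx) => [Z' /YX[Z VZ ZZ'] <-].
  rewrite -ZZ'// -lfunE; apply: memv_img.
  by apply/(distributionP _ _ Dx); exists Z.
move=> /memv_imgP[v /(distributionP _ _ Dx)[Z /XY[Z' VZ' ZZ'] <-] ->].
by rewrite lfunE ZZ'//; apply/(distributionP _ _ Efx); exists Z'.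
Qed.

Lemma dist_rank_le (R : realType) (n : nat) (D : set 'rV[R]_n)
    (X : lie_system D) (x : 'rV[R]_n) : (dist_rank X x <= n)%N.
Proof.
by have := dimvS (subvf (Defs.distribution X x)); rewrite dimvf /= /dim /= mul1n.
Qed.

Unset Implicit Arguments.
Set Strict Implicit.

Theorem proposition3p3 (R : realType) (n m : nat) (hmn : (m < n)%N)
    (X : lie_system [set: 'rV[R]_n]) (Y : lie_system [set: 'rV[R]_m])
    (U : set 'rV[R]_n) (U' : set 'rV[R]_m) (rX rY : nat)
    (hX : max_rank_on X U rX) (hY : max_rank_on Y U' rY)
    (hr : rX <> rY) :
  ~ locally_diffeomorphic_lower Y X.
Proof.
move=> [W' [Xr [[_ rkX [N [phi [lam [W [f [g red]]]]]] ldY]]]].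
move: red => [[_ NU _] _ _ [[Q _ WE] [fW _ _ _]] [_ cf]].
move: ldY => [A [B [h [k [[oA [u Au] AW'] [oB _ _] hk ch]]]]].
apply: hr.
have W'u := AW' u Au.
have Ufu : max_rank_set X (f u).
  by apply: NU; have [+ _] := fW u W'u; rewrite WE => -[_ []].
have -> : rX = m by rewrite -(rkX _ Ufu); case: hX => UE ->//; rewrite UE.
have rkXr : dist_rank Xr u = m.
  (* For the lower bound, [m] is the rank of [X] at [f u], hence the dimension of the image of the
     distribution of [Xr] under ['d f u]; rank-nullity bounds it by the rank of [Xr]. *)
  apply/eqP; rewrite eqn_leq dist_rank_le /= -{1}(rkX _ Ufu) /dist_rank.
  rewrite (carries_onto_distribution cf W'u W'u I).
  by rewrite -(limg_ker_dim (linfun ('d f u)) (Defs.distribution Xr u)) leq_addl.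
have rkY : dist_rank Y (h u) = m.
  rewrite /dist_rank.
  rewrite (carries_onto_distribution ch Au W'u I).
  suff /eqP kh0 : lker (linfun ('d h u)) == 0%VS.
    by rewrite limg_dim_eq// kh0 capv0.
  apply/lker0P => v w; rewrite !lfunE.
  exact: (diffeo_diff_inj oA oB hk Au).
(* Rank [m] is the ambient dimension, so no point exceeds it and [h u] lies in [U'], whence
   [rY = m]. *)
case: hY => UE rkU'; rewrite -(rkU' (h u)) ?rkY// UE; split=> // y _.
by rewrite rkY dist_rank_le.
Qed.
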